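(* Let $\Gamma$ be a countable discrete group acting by homeomorphisms on a compact Hausdorff space $X$, and let $\mu\in\mathrm{Prob}(\Gamma)$ be generating. Suppose $\nu\in\mathrm{Prob}(X)$ is an ergodic $\mu$-stationary measure such that $(X,\nu)$ has no non-trivial finite factor. If $\mathcal{F}$ is a $\Gamma$-Noetherian lower semilattice in $\mathrm{MALG}(\nu)$, then $\nu(Y)\in\{0,1\}$ for every $Y\in\mathcal{F}$.
   Context: $\mathrm{Prob}(X)$ is the set of Borel probability measures on $X$; $\nu$ is $\mu$-stationary if $\sum_g\mu(g)\,g\nu=\nu$. $\mu$ is generating if the semigroup generated by $\{g:\mu(g)>0\}$ is $\Gamma$ (then $\mu$-stationary measures are non-singular). $\mathrm{MALG}(\nu)$ is the Boolean algebra of measurable subsets of $X$ modulo $\nu$-null sets, partially ordered by inclusion, with the induced $\Gamma$-action. A collection $\mathcal{F}\subset\mathrm{MALG}(\nu)$ is a $\Gamma$-Noetherian lower semilattice if it is $\Gamma$-invariant, closed under (finite) intersections, and every descending chain $Y_1\geq Y_2\geq\cdots$ in $\mathcal{F}$ stabilizes. A non-trivial finite factor is a measurable $\Gamma$-equivariant factor of $(X,\nu)$ that is a finite probability space with more than one point of positive measure. *)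

(* Defs.v *)
From HB Require Import structures.
From mathcomp Require Import all_boot all_order all_algebra.
From mathcomp Require Import all_classical all_reals all_analysis.
From mathcomp Require Import esum generic_quotient.

Set Implicit Arguments.
Unset Strict Implicit.
Unset Printing Implicit Defensive.

Import Order.TTheory GRing.Theory Num.Theory.

Local Open Scope classical_set_scope.
Local Open Scope quotient_scope.
Local Open Scope ring_scope.
Local Open Scope ereal_scope.

(* A measurableType has to be pointed, whence ptopologicalType; this is no
   restriction for a space carrying a probability measure. *)
Definition borel (X : ptopologicalType) := g_sigma_algebraType (@open X).

HB.instance Definition _ (X : ptopologicalType) := Measurable.on (borel X).

(* The Borel structure of the discrete topology: every subset is measurable. *)
Definition discrete_group (G : groupType) : Type := G.

Section discrete_group.
Variable G : groupType.

HB.instance Definition _ := Choice.on (discrete_group G).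
HB.instance Definition _ :=
  isPointed.Build (discrete_group G) (1%g : G).
HB.instance Definition _ := @isMeasurable.Build default_measure_display
  (discrete_group G) (@discrete_measurable G) (@discrete_measurable0 G)
  (@discrete_measurableC G) (@discrete_measurableU G).

End discrete_group.

Section actions.
Variable G : groupType.

Record is_action (T : Type) (act : G -> T -> T) : Prop := IsAction {
  is_action1 : forall x, act 1%g x = x ;
  is_actionM : forall g h x, act (g * h)%g x = act g (act h x) }.

(* Each [act g] is a homeomorphism, its inverse being [act g^-1]. *)
Record homeo_action (X : topologicalType) := HomeoAction {
  act_fun :> G -> X -> X ;
  act_is_action : is_action act_fun ;
  act_continuous : forall g, continuous (act_fun g) }.

Definition borel_act (X : ptopologicalType) (act : homeo_action X) (g : G) :
  borel X -> borel X := act g.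

Definition semigroup_generated (S : set G) : set G :=
  smallest [set M | forall g h, M g -> M h -> M (g * h)%g] S.

Definition generating (R : realType)
    (mu : probability (discrete_group G) R) : Prop :=
  semigroup_generated [set g | 0 < mu [set g]] = [set: G].

End actions.

Section stationary.
Variables (R : realType) (G : groupType) (X : ptopologicalType).
Variable act : homeo_action G X.

Definition stationary (mu : probability (discrete_group G) R)
    (nu : probability (borel X) R) : Prop :=
  forall A, measurable A ->
    \esum_(g in [set: G]) (mu [set g] * pushforward nu (borel_act act g) A)
    = nu A.

Definition ergodic (nu : probability (borel X) R) : Prop :=
  forall A, measurable A -> (forall g, borel_act act g @` A = A) ->
    nu A = 0 \/ nu A = 1.

(* [beta] is the action on the finite probability space [(Y, m)]. As usual for
   factors of probability spaces, [pi] is equivariant almost everywhere. *)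
Definition has_nontrivial_finite_factor (nu : probability (borel X) R) : Prop :=
  exists (d : measure_display) (Y : measurableType d) (m : probability Y R)
         (beta : G -> Y -> Y) (pi : {mfun borel X >-> Y}),
    [/\ finite_set [set: Y] /\ (forall B : set Y, measurable B),
        is_action beta,
        forall B, measurable B -> pushforward nu pi B = m B,
        forall g, {ae nu, forall x, pi (borel_act act g x) = beta g (pi x)} &
        exists y1 y2, [/\ y1 <> y2, 0 < m [set y1] & 0 < m [set y2]] ].

End stationary.

Section malg_quotient.
Context d (T : measurableType d) (R : realType).
Variable nu : {measure set T -> \bar R}.

Definition msets : Type := set_type (@measurable d T).
HB.instance Definition _ := SubType.on msets.
HB.instance Definition _ := Choice.on msets.

Definition mset (A : set T) (mA : measurable A) : msets :=
  exist _ A (mem_set mA).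

Lemma measurable_mset (A : msets) : measurable (\val A).
Proof. exact: (set_mem (valP A)). Qed.

Definition malg_eqv (A B : msets) : bool := nu (\val A `+` \val B) == 0.

Lemma null_sub2 (A B C : set T) : measurable A -> measurable B ->
  measurable C -> A `<=` B `|` C -> nu B = 0 -> nu C = 0 -> nu A = 0.
Proof.
move=> mA mB mC ABC B0 C0.
apply: (@subset_measure0 _ _ _ nu A (B `|` C)) => //; first exact: measurableU.
by apply: null_set_setU.
Qed.

Lemma malg_eqv_refl : reflexive malg_eqv.
Proof. by move=> A; rewrite /malg_eqv setYK measure0. Qed.

Lemma malg_eqv_sym : symmetric malg_eqv.
Proof. by move=> A B; rewrite /malg_eqv setYC. Qed.

Lemma malg_eqv_trans : transitive malg_eqv.
Proof.
move=> B A C /eqP AB /eqP BC; apply/eqP.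
have mA := measurable_mset A; have mB := measurable_mset B.
have mC := measurable_mset C.
apply: null_sub2 AB BC; try by apply: measurableU; exact: measurableD.
by move=> x /=; have [Bx|Bx] := pselect (\val B x); tauto.
Qed.

Canonical malg_equiv :=
  EquivRel malg_eqv malg_eqv_refl malg_eqv_sym malg_eqv_trans.

Definition malg : Type := {eq_quot malg_eqv}.
HB.instance Definition _ := Choice.on malg.
HB.instance Definition _ := EqQuotient.on malg.

Definition malg_le (Y Z : malg) : bool :=
  nu (\val (repr Y) `\` \val (repr Z)) == 0.

Definition malg_meet (Y Z : malg) : malg :=
  \pi_malg (mset (measurableI _ _ (measurable_mset (repr Y))
                             (measurable_mset (repr Z)))).

Definition malg_measure (Y : malg) : \bar R := nu (\val (repr Y)).

Lemma malg_piP (A B : msets) :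
  \pi_malg A = \pi_malg B <-> nu (\val A `+` \val B) = 0.
Proof.
split=> [/eqP|AB]; first by rewrite eqmodE => /eqP.
by apply/eqP; rewrite eqmodE; apply/eqP.
Qed.

Lemma repr_malg_pi (A : msets) : nu (\val (repr (\pi_malg A)) `+` \val A) = 0.
Proof. by apply/malg_piP; rewrite reprK. Qed.

Lemma malg_le_pi (A B : msets) :
  malg_le (\pi_malg A) (\pi_malg B) = (nu (\val A `\` \val B) == 0).
Proof.
have mv := measurable_mset.
have A0 := repr_malg_pi A; have B0 := repr_malg_pi B.
have C0 := null_set_setU _ _ A0 B0.
rewrite /malg_le; apply/eqP/eqP => AB0; apply: null_sub2 AB0 (C0 _ _).
all: try by repeat first [exact: mv | apply: measurableU | apply: measurableD].
- by move=> x /=; have := EM (\val (repr (\pi_malg A)) x);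
    have := EM (\val (repr (\pi_malg B)) x); tauto.
- by move=> x /=; have := EM (\val A x); have := EM (\val B x); tauto.
Qed.

Lemma malg_meet_pi (A B : msets) : malg_meet (\pi_malg A) (\pi_malg B) =
  \pi_malg (mset (measurableI _ _ (measurable_mset A) (measurable_mset B))).
Proof.
have mv := measurable_mset.
have A0 := repr_malg_pi A; have B0 := repr_malg_pi B.
apply/malg_piP => /=; apply: null_sub2 A0 B0.
all: try by repeat first
  [exact: mv | apply: measurableU | apply: measurableD | apply: measurableI].
move=> x /=; have := EM (\val (repr (\pi_malg A)) x).
by have := EM (\val (repr (\pi_malg B)) x);
  have := EM (\val A x); have := EM (\val B x); tauto.
Qed.

Lemma malg_measure_pi (A : msets) : malg_measure (\pi_malg A) = nu (\val A).
Proof.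
have mv := measurable_mset.
have mY (B C : msets) : measurable (\val B `+` \val C).
  by apply: measurableU; apply: measurableD.
suff le (B C : msets) : nu (\val B `+` \val C) = 0 -> nu (\val B) <= nu (\val C).
  apply/eqP; rewrite eq_le /malg_measure; apply/andP; split; apply: le.
    exact: repr_malg_pi.
  by rewrite setYC; exact: repr_malg_pi.
move=> BC0; have <- : nu (\val C `|` (\val B `+` \val C)) = nu (\val C).
  by rewrite measureU0.
apply: le_measure; rewrite ?inE; [exact: mv|by apply: measurableU|].
by move=> x /= Bx; have := EM (\val C x); tauto.
Qed.

Lemma malg_le_refl : reflexive malg_le.
Proof. by move=> Y; rewrite /malg_le setDv measure0. Qed.

Lemma malg_le_anti : antisymmetric malg_le.
Proof.
move=> Y Z /andP[/eqP YZ /eqP ZY]; rewrite -(reprK Y) -(reprK Z).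
by apply/malg_piP/null_set_setU => //; apply: measurableD; exact: measurable_mset.
Qed.

Lemma malg_le_trans : transitive malg_le.
Proof.
have mv := measurable_mset.
move=> Z Y W /eqP YZ /eqP ZW; apply/eqP; apply: null_sub2 YZ ZW.
all: try by apply: measurableD; exact: mv.
by move=> x /=; have := EM (\val (repr Z) x); tauto.
Qed.

HB.instance Definition _ := Order.Le_isPOrder.Build Order.default_display malg
  malg_le_refl malg_le_anti malg_le_trans.

Lemma malg_meetP (Y Z W : malg) :
  malg_le Y (malg_meet Z W) = malg_le Y Z && malg_le Y W.
Proof.
rewrite -(reprK Y) -(reprK Z) -(reprK W) malg_meet_pi !malg_le_pi /=.
set A := \val (repr Y); set B := \val (repr Z); set C := \val (repr W).
have mA : measurable A := measurable_mset _.
have mB : measurable B := measurable_mset _.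
have mC : measurable C := measurable_mset _.
have mAB := measurableD mA mB; have mAC := measurableD mA mC.
have mABC := measurableD mA (measurableI _ _ mB mC).
apply/eqP/andP => [N0|[/eqP AB /eqP AC]].
  by split; apply/eqP; apply: (subset_measure0 _ mABC _ N0) => // x /=; tauto.
apply: null_sub2 AB AC => // x /=.
by have := EM (B x); have := EM (C x); tauto.
Qed.

HB.instance Definition _ :=
  Order.POrder_isMeetSemilattice.Build Order.default_display malg malg_meetP.

End malg_quotient.

Section malg_action.
Variables (R : realType) (G : groupType) (X : ptopologicalType).
Variable act : homeo_action G X.

Lemma act_imageE (g : G) (A : set (borel X)) :
  borel_act act g @` A = borel_act act g^-1%g @^-1` A.
Proof.
have [act1 actM] := act_is_action act; rewrite /borel_act.
apply/seteqP; split=> [_ [x Ax <-]|x Ax] /=.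
  by rewrite -actM mulVg act1.
by exists (act g^-1%g x) => //; rewrite -actM mulgV act1.
Qed.

Lemma measurable_borel_act (g : G) : measurable_fun setT (borel_act act g).
Proof.
apply: (@measurability _ _ _ _ _ _ (@open X : set (set (borel X)))) => //.
move=> _ [U oU <-]; rewrite setTI.
apply: sub_sigma_algebra.
by have /continuousP := @act_continuous _ _ act g; apply.
Qed.

Lemma measurable_act_image (g : G) (A : set (borel X)) :
  measurable A -> measurable (borel_act act g @` A).
Proof.
move=> mA; rewrite act_imageE -[X in measurable X]setTI.
exact: measurable_borel_act.
Qed.

Variable nu : probability (borel X) R.

(* [gY] is the class of [gA], where [A] represents [Y]; by [malg_act_pi] and
   [stationary_nonsingular] it does not depend on [A]. *)
Definition malg_act (g : G) (Y : malg nu) : malg nu :=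
  \pi_(malg nu) (mset (measurable_act_image g (measurable_mset (repr Y)))).

Definition nonsingular : Prop :=
  forall g A, measurable A -> nu A = 0 -> nu (borel_act act g @` A) = 0.

Lemma malg_act_pi (g : G) (A : msets (borel X)) : nonsingular ->
  malg_act g (\pi_(malg nu) A) =
    \pi_(malg nu) (mset (measurable_act_image g (measurable_mset A))).
Proof.
move=> ns; apply/malg_piP => /=.
have /(ns g _ _) := repr_malg_pi nu A; rewrite !act_imageE; apply.
by apply: measurableU; apply: measurableD; exact: measurable_mset.
Qed.

Lemma stationary_nonsingular (mu : probability (discrete_group G) R) :
  generating mu -> stationary act mu nu -> nonsingular.
Proof.
move=> gen st; have [act1 actM] := act_is_action act.
pose S : set G := [set g | forall A, measurable A -> nu A = 0 ->
  nu (borel_act act g @^-1` A) = 0].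
suff ST : [set: G] `<=` S by move=> g A mA A0; rewrite act_imageE; apply: ST.
rewrite -gen; apply: smallest_sub => [g h Sg Sh A mA A0|g /= mug A mA A0].
  have -> : borel_act act (g * h)%g @^-1` A =
      borel_act act h @^-1` (borel_act act g @^-1` A).
    by apply/seteqP; split=> x; rewrite /borel_act /= actM.
  apply: Sh; last exact: Sg.
  by rewrite -[X in measurable X]setTI; exact: measurable_borel_act.
have := st A mA; rewrite A0 => s0.
have : mu [set g] * pushforward nu (borel_act act g) A <= 0.
  rewrite -s0; apply: esum_ge; exists [set g].
    by split=> //; exact: finite_set1.
  by rewrite fsbig_set1.
move=> le0; apply/eqP; rewrite eq_le measure_ge0 andbT leNgt; apply/negP => lt0.
by move: le0; rewrite leNgt mule_gt0.
Qed.

Record noetherian_lower_semilattice (F : set (malg nu)) : Prop := {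
  lsl_invariant : forall g Y, F Y -> F (malg_act g Y) ;
  lsl_meet : forall Y Z, F Y -> F Z -> F (Order.meet Y Z) ;
  lsl_noetherian : forall Y_ : nat -> malg nu, (forall n, F (Y_ n)) ->
    (forall n, (Y_ n.+1 <= Y_ n)%O) ->
    exists N, forall n, (N <= n)%N -> Y_ n = Y_ N }.

End malg_action.

(* Main.v *)
(* By the descending chain condition, any element of positive measure of the
   semilattice F lies above a minimal such element Y, and minimality makes any
   two translates of Y equal or disjoint up to null sets. As nu is finite, only
   finitely many translates have measure at least nu(Y), so nu attains a maximum
   on the orbit of Y; by stationarity and the maximum principle nu is then
   constant on the orbit, which is therefore finite. By ergodicity the orbit
   covers X up to a null set, so it is a finite factor of X, hence it
   is reduced to Y, and nu(Y) = 1. *)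

Require Import Defs.
From HB Require Import structures.
From mathcomp Require Import all_boot all_order all_algebra.
From mathcomp Require Import all_classical all_reals all_analysis.
From mathcomp Require Import finmap esum generic_quotient.

Set Implicit Arguments.
Unset Strict Implicit.
Unset Printing Implicit Defensive.

Import Order.TTheory GRing.Theory Num.Theory.

Local Open Scope classical_set_scope.
Local Open Scope quotient_scope.
Local Open Scope ring_scope.
Local Open Scope ereal_scope.

(** * Unions over countable index sets *)

Lemma countable_bigcup_seq (I T : Type) (D : set I) (F : I -> set T) :
  countable D -> exists H : nat -> set T,
    \bigcup_(i in D) F i = \bigcup_n H n /\
    forall n, H n = set0 \/ exists2 i, D i & H n = F i.
Proof.
move=> /countable_injP[f finj].
(* The [n]-th set is the union over the indices that the injection [f] sends to [n]. There is at
   most one such index, and the set is empty if there is none. *)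
exists (fun n => \bigcup_(i in D `&` f @^-1` [set n]) F i); split.
  by apply/seteqP; split=> [x [i Di Fix]|x [n _ [i [Di _] Fix]]];
    [exists (f i) => //; exists i|exists i].
move=> n; have [[i [Di fi]]|ni] := pselect (exists i, D i /\ f i = n).
  right; exists i => //; apply/seteqP; split=> [x [j [Dj /= fj]]|x Fix].
    by rewrite (finj i j (mem_set Di) (mem_set Dj) (etrans fi (esym fj))).
  by exists i.
by left; apply/seteqP; split=> // x [i [Di /= fi] _]; apply: ni; exists i.
Qed.

Lemma countable_bigcup_measurable d (T : measurableType d) (I : Type)
    (D : set I) (F : I -> set T) : countable D ->
  (forall i, D i -> measurable (F i)) -> measurable (\bigcup_(i in D) F i).
Proof.
move=> /(@countable_bigcup_seq _ _ _ F)[H [-> HF]] mF.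
by apply: bigcupT_measurable => n; have [->|[i Di ->]] := HF n; auto.
Qed.

Lemma countable_negligible_bigcup d (T : measurableType d) (R : realType)
    (nu : {measure set T -> \bar R}) (I : Type) (D : set I) (F : I -> set T) :
  countable D -> (forall i, D i -> nu.-negligible (F i)) ->
  nu.-negligible (\bigcup_(i in D) F i).
Proof.
move=> /(@countable_bigcup_seq _ _ _ F)[H [-> HF]] nF.
apply: negligible_bigcup => n; have [->|[i Di ->]] := HF n; auto.
exact: negligible_set0.
Qed.

(** * Almost everywhere disjoint families in the measure algebra *)

Section ae_disjoint.
Context d (T : measurableType d) (R : realType) (nu : probability T R).
Implicit Types (O : set (malg nu)) (Y Z W : malg nu).

Lemma malg_measure_meet Y Z :
  malg_measure (Order.meet Y Z) = nu (\val (repr Y) `&` \val (repr Z)).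
Proof. by rewrite [LHS]malg_measure_pi. Qed.

Lemma malg_measure_ge0 Y : 0 <= malg_measure Y.
Proof. exact: measure_ge0. Qed.

Lemma le_malg_measure Y Z : (Y <= Z)%O -> malg_measure Y <= malg_measure Z.
Proof.
move=> /eqP YZ; rewrite /malg_measure.
have mv := @measurable_mset _ T.
rewrite -(measureU0 (mv (repr Z)) (measurableD (mv _) (mv _)) YZ).
apply: le_measure; [exact: mem_set (mv _)|apply: mem_set|].
  by apply: measurableU; [exact: mv|apply: measurableD; exact: mv].
by move=> x /= Yx; have := EM (\val (repr Z) x); tauto.
Qed.

(* Makes the almost everywhere disjoint members of [O] genuinely disjoint. *)
Definition core O Z : set T :=
  \val (repr Z) `\` \bigcup_(W in O `\ Z) \val (repr W).

Lemma trivIset_core O : trivIset O (core O).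
Proof.
move=> Y Z OY OZ [x [[Yx nYx] [Zx nZx]]].
apply: contrapT => YZ; apply: nYx; exists Z => //.
by split=> // /esym.
Qed.

Definition ae_disjoint O := forall Y Z, O Y -> O Z -> Y <> Z ->
  malg_measure (Order.meet Y Z) = 0.

Lemma measurable_core O Z : countable O -> measurable (core O Z).
Proof.
move=> cO; apply: measurableD; first exact: measurable_mset.
apply: countable_bigcup_measurable => [|W _]; last exact: measurable_mset.
by apply: sub_countable cO; apply: subset_card_le => W [].
Qed.

(** What [Z] loses in its core is a countable union of null intersections with the other members. *)
Lemma core_negligible O Z : countable O -> ae_disjoint O -> O Z ->
  nu.-negligible (\val (repr Z) `\` core O Z).
Proof.
move=> cO dO OZ.
apply: (@negligibleS _ _ _ _
  (\bigcup_(W in O `\ Z) (\val (repr Z) `&` \val (repr W)))) => [x [Zx nx]|].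
  apply: contrapT => nU; apply: nx; split=> // -[W OW Wx].
  by apply: nU; exists W.
apply: countable_negligible_bigcup.
  by apply: sub_countable cO; apply: subset_card_le => W [].
move=> W [OW /= WZ]; apply/negligibleP.
  by apply: measurableI; exact: measurable_mset.
by rewrite -[LHS]malg_measure_meet dO// => /esym.
Qed.

Lemma measure_core O Z : countable O -> ae_disjoint O -> O Z ->
  nu (core O Z) = malg_measure Z.
Proof.
move=> cO dO OZ; have mZ := measurable_mset (repr Z).
have mC := measurable_core Z cO.
rewrite /malg_measure
  -{1}(_ : core O Z `|` (\val (repr Z) `\` core O Z) = \val (repr Z)).
  rewrite measureU0//; first exact: measurableD.
  by apply/negligibleP; [exact: measurableD|exact: core_negligible].
by rewrite setDUK// => x [].
Qed.

(** The cores of [n] members are disjoint sets of measure at least [e], so [n] times [e] is at most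
    1; this bounds [n]. *)
Lemma ae_disjoint_finite O e : countable O -> ae_disjoint O -> 0 < e ->
  (forall Z, O Z -> e <= malg_measure Z) -> finite_set O.
Proof.
move=> cO dO e0 Oe; apply: contrapT => infO.
(* Any member [Z0] shows that [e] is finite, being at most the measure of [Z0]. *)
have [Z0 OZ0] := infinite_setN0 infO.
have /fineK er : e \is a fin_num.
  rewrite ge0_fin_numE ?ltW//; apply: le_lt_trans (Oe _ OZ0) _.
  by apply: le_lt_trans (ltry 1); exact/probability_le1/measurable_mset.
move: e0 Oe; rewrite -er lte_fin; move: (fine e) => {e er} r r0 Or.
have bound n : r%:E *+ n <= 1.
  have [B BO nB] := infinite_set_fset n infO.
  have mD Z (_ : [set` B] Z) := measurable_core Z cO.
  have fB := finite_fset B.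
  apply: le_trans (probability_le1 nu (fin_bigcup_measurable fB mD)).
  rewrite measure_fin_bigcup//; last first.
    exact: (sub_trivIset BO (@trivIset_core O)).
  rewrite fsbig_finite//= set_fsetK.
  apply: le_trans (_ : \sum_(Z <- B) r%:E <= _); last first.
    rewrite !big_seq; apply: lee_sum => Z ZB.
    have OZ : O Z by exact: BO.
    by rewrite measure_core//; exact: Or.
  rewrite sumEFin big_const_seq count_predT iter_addr addr0.
  by rewrite -EFin_natmul lee_fin; apply: ler_wpMn2l => //; exact: ltW.
(* By the Archimedean property this integer exceeds [r^-1], so its product with [r] exceeds 1. *)
have := bound (Num.bound r^-1).
rewrite -EFin_natmul lee_fin leNgt => /negP; apply.
rewrite -mulr_natr -ltr_pdivrMl// mulr1.
by apply: archi_boundP; rewrite invr_ge0 ltW.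
Qed.

End ae_disjoint.

(** * The action on the measure algebra and minimal elements of positive measure *)

Section malg_action.
Context (R : realType) (G : groupType) (X : ptopologicalType).
Variables (act : homeo_action G X) (nu : probability (borel X) R).
Implicit Types (F : set (malg nu)) (Y Z W : malg nu) (g h : G).

Lemma act_image1 (A : set (borel X)) : borel_act act 1%g @` A = A.
Proof.
rewrite act_imageE invg1; apply/seteqP.
by split=> x; rewrite /= /borel_act (is_action1 (act_is_action act)).
Qed.

Lemma act_imageM g h (A : set (borel X)) :
  borel_act act (g * h)%g @` A = borel_act act g @` (borel_act act h @` A).
Proof.
rewrite !act_imageE invgM; apply/seteqP.
by split=> x; rewrite /= /borel_act (is_actionM (act_is_action act)).
Qed.

Lemma malg_act1 Y : malg_act act 1%g Y = Y.
Proof.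
rewrite -[RHS]reprK; apply/malg_piP => /=.
by rewrite act_image1 setYK measure0.
Qed.

Lemma malg_measure_act g Y :
  malg_measure (malg_act act g Y) = nu (borel_act act g @` \val (repr Y)).
Proof. exact: malg_measure_pi. Qed.

Hypothesis ns : nonsingular act nu.

Lemma malg_actM g h Y :
  malg_act act (g * h)%g Y = malg_act act g (malg_act act h Y).
Proof.
rewrite [malg_act act h Y]/malg_act malg_act_pi//; apply/malg_piP => /=.
by rewrite act_imageM setYK measure0.
Qed.

Lemma malg_actK g : cancel (malg_act act (nu := nu) g) (malg_act act g^-1%g).
Proof. by move=> Y; rewrite -malg_actM mulVg malg_act1. Qed.

Lemma malg_actVK g : cancel (malg_act act (nu := nu) g^-1%g) (malg_act act g).
Proof. by move=> Y; rewrite -malg_actM mulgV malg_act1. Qed.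

Lemma le_malg_act g Y Z :
  (Y <= Z)%O -> (malg_act act g Y <= malg_act act g Z)%O.
Proof.
move=> /eqP YZ; rewrite [(_ <= _)%O]malg_le_pi /= !act_imageE.
apply/eqP; have := ns g _ YZ; rewrite act_imageE; apply.
by apply: measurableD; exact: measurable_mset.
Qed.

Lemma malg_act_gt0 g Y :
  0 < malg_measure Y -> 0 < malg_measure (malg_act act g Y).
Proof.
rewrite !lt0e !malg_measure_ge0 !andbT; apply: contra => /eqP Z0.
apply/eqP; rewrite -(malg_actK g Y) malg_measure_act.
by apply: ns Z0; exact: measurable_mset.
Qed.

(** Minimality is only among members of positive measure, since [F] may contain the null class. *)
Record positive_minimal F Y : Prop := {
  pm_in : F Y ;
  pm_gt0 : 0 < malg_measure Y ;
  pm_min : forall W, F W -> (W <= Y)%O -> 0 < malg_measure W -> W = Y }.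

(** Otherwise every positive member below [Z] has a strictly smaller one, and dependent choice
    builds a descending chain that never stabilizes. *)
Lemma noetherian_positive_minimal F Z : noetherian_lower_semilattice act F ->
  F Z -> 0 < malg_measure Z -> exists2 Y, (Y <= Z)%O & positive_minimal F Y.
Proof.
move=> [_ _ dcc] FZ Z0; apply: contrapT => noY.
pose T := {Y : malg nu | [/\ F Y, 0 < malg_measure Y & (Y <= Z)%O]}.
have step (y : T) : {w : T | (sval w < sval y)%O}.
  apply: cid; apply: contrapT => nw; case: y nw => Y /= [FY Y0 YZ] nw.
  apply: noY; exists Y => //; split=> // W FW WY W0.
  apply: contrapT => nWY; apply: nw.
  exists (exist _ W (And3 FW W0 (le_trans WY YZ))) => /=.
  by rewrite lt_neqAle WY andbT; apply/eqP.
have [f [_ fS]] := dependent_choice step (exist _ Z (And3 FZ Z0 (lexx Z))).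
have [||N fN] := dcc (fun n => sval (f n)).
- by move=> n; case: (svalP (f n)).
- by move=> n; exact/ltW/fS.
- by have := fS N; rewrite (fN N.+1)// ltxx.
Qed.

(** A competitor [W] below [gY] is pulled back by [g^-1] to a competitor below [Y]. *)
Lemma positive_minimal_act F g Y : noetherian_lower_semilattice act F ->
  positive_minimal F Y -> positive_minimal F (malg_act act g Y).
Proof.
move=> [Fact _ _] [FY Y0 Ymin]; split; [exact: Fact|exact: malg_act_gt0|].
move=> W FW WgY W0; rewrite -[LHS](malg_actVK g); congr malg_act.
apply: Ymin; [exact: Fact| |exact: malg_act_gt0].
by rewrite -(malg_actK g Y); exact: le_malg_act.
Qed.

Definition malg_orbit Y : set (malg nu) := range (fun g => malg_act act g Y).

Lemma malg_orbit_act g Y Z :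
  malg_orbit Y Z -> malg_orbit Y (malg_act act g Z).
Proof. by move=> [h _ <-]; exists (g * h)%g => //; rewrite malg_actM. Qed.

Lemma countable_malg_orbit Y : countable [set: G] -> countable (malg_orbit Y).
Proof. by move=> cG; apply: sub_countable cG; exact: card_image_le. Qed.

(** If two translates meet in positive measure, their meet lies in [F] and by minimality equals both
    of them. *)
Lemma ae_disjoint_malg_orbit F Y : noetherian_lower_semilattice act F ->
  positive_minimal F Y -> ae_disjoint (malg_orbit Y).
Proof.
move=> NF mY _ _ [g _ <-] [h _ <-] gh.
have [FgY _ gmin] := positive_minimal_act g NF mY.
have [FhY _ hmin] := positive_minimal_act h NF mY.
(* As the measure is nonnegative, its vanishing is restated as not being positive. *)
apply/eqP; rewrite -[_ == _]negbK -[X in ~~ X]andbT.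
rewrite -(malg_measure_ge0 (Order.meet (malg_act act g Y) (malg_act act h Y))).
rewrite -lt0e; apply/negP => W0; apply: gh.
have FW := lsl_meet NF FgY FhY.
by rewrite -(gmin _ FW (leIl _ _) W0) {1}(hmin _ FW (leIr _ _) W0).
Qed.

End malg_action.

(** * The maximum principle for stationary measures *)

Section maximum_principle.
Context (R : realType) (G : groupType) (X : ptopologicalType).
Variables (act : homeo_action G X) (mu : probability (discrete_group G) R).
Variable nu : probability (borel X) R.

Lemma esum_probability_le1 : \esum_(g in [set: G]) mu [set g] <= 1.
Proof.
apply: ge_ereal_sup => _ [D [finD _] <-].
rewrite -(@measure_fin_bigcup _ _ _ mu _ D (fun g => [set g]))//.
  exact: probability_le1.
by move=> g h _ _ [x [/= -> ->]].
Qed.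

Hypothesis st : stationary act mu nu.

(* Stationarity averages over the inverses: [nu Z] is the [mu]-average of
   [nu (g^-1 Z)]. *)
Lemma stationary_max (O : set (malg nu)) (M : \bar R) :
  (forall g Z, O Z -> O (malg_act act g Z)) ->
  (forall Z, O Z -> malg_measure Z <= M) ->
  forall g Z, 0 < mu [set g] -> O Z -> malg_measure Z = M ->
    malg_measure (malg_act act g^-1%g Z) = M.
Proof.
move=> Oact OM g Z g0 OZ ZM.
pose c h := malg_measure (malg_act act h^-1%g Z).
have cM h : c h <= M by exact/OM/Oact.
have M0 : 0 <= M by rewrite -ZM malg_measure_ge0.
have Mfin : M \is a fin_num.
  by rewrite -ZM; apply: fin_num_measure; exact: measurable_mset.
have cfin h : c h \is a fin_num.
  by apply: fin_num_measure; exact: measurable_mset.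
have cE h : pushforward nu (borel_act act h) (\val (repr Z)) = c h.
  by rewrite /c malg_measure_act act_imageE invgK.
have := st (measurable_mset (repr Z)).
rewrite [RHS]ZM; under eq_esum do rewrite cE; move=> Esum.
(* Each [M] splits into [c h] and the deficit [M - c h]. By stationarity the average of [c] is
   already [M], so the weighted deficits sum to at most 0. *)
have dec :
    \esum_(h in [set: G]) (mu [set h] * c h + mu [set h] * (M - c h)) <= M.
  rewrite (_ : esum _ _ = \esum_(h in [set: G]) (mu [set h] * M)); last first.
    apply: eq_esum => h _; rewrite -muleDr ?fin_num_adde_defr//.
      by rewrite addeC subeK.
    by apply: fin_num_measure.
  apply: ge_ereal_sup => _ [D [finD _] <-].
  rewrite -ge0_mule_fsuml// -[leRHS]mul1e; apply: lee_wpmul2r => //.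
  apply: le_trans esum_probability_le1.
  by apply: ereal_sup_ubound; exists D.
move: dec; rewrite esumD => [|h _|h _]; last 2 first.
- by apply: mule_ge0; [exact: measure_ge0|exact: malg_measure_ge0].
- by apply: mule_ge0; [exact: measure_ge0|rewrite sube_ge0 ?cfin].
rewrite Esum -leeBrDl// subee// => le0.
apply/eqP; rewrite eq_le (cM g) /= -/(c g).
rewrite leNgt -sube_gt0 //; apply/negP => gM.
(* The deficits are nonnegative, so the single term at [g] is bounded by the whole sum. *)
have : mu [set g] * (M - c g) <= 0.
  apply: le_trans le0; apply: esum_ge; exists [set g].
    by split=> //; exact: finite_set1.
  by rewrite fsbig_set1.
by rewrite leNgt mule_gt0.
Qed.

Hypothesis gen : generating mu.

Lemma generating_max (O : set (malg nu)) (M : \bar R) :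
  (forall g Z, O Z -> O (malg_act act g Z)) ->
  (forall Z, O Z -> malg_measure Z <= M) ->
  forall g Z, O Z -> malg_measure Z = M ->
    malg_measure (malg_act act g Z) = M.
Proof.
move=> Oact OM g.
have ns := stationary_nonsingular gen st.
(* The one-step principle moves by inverses, so the semigroup consists of those [h] whose inverse
   preserves maximality. It contains the support of [mu], hence is all of [G]. *)
pose S := [set h | forall Z, O Z -> malg_measure Z = M ->
  malg_measure (malg_act act h^-1%g Z) = M].
suff ST : [set: G] `<=` S by rewrite -[g]invgK; exact: ST.
rewrite -gen; apply: smallest_sub => [h k Sh Sk Z OZ ZM|h /= h0 Z].
  rewrite invgM malg_actM//; apply: Sk; [exact: Oact|exact: Sh].
exact: stationary_max.
Qed.

End maximum_principle.

(** * Maxima over finite sets, and discrete measurable spaces *)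

Lemma finite_set_max (R : realType) (T : Type) (A : set T)
    (f : T -> \bar R) : finite_set A -> A !=set0 ->
  exists2 x, A x & forall y, A y -> f y <= f x.
Proof.
elim/Pchoice: T => T in A f *.
move=> /finite_seqP[s ->] [a /= ax]; elim: s a ax => // b s IH a _.
case: s IH => [_|c s IH]; first by
  exists b => [|y] /=; rewrite mem_seq1 // => /eqP ->.
have [x xs xM] := IH c (mem_head _ _).
have [fbx|/ltW fxb] := leP (f b) (f x).
  by exists x => [|y] /=; rewrite inE ?xs ?orbT// => /predU1P[->|/xM].
exists b => [|y] /=; first exact: mem_head.
by rewrite inE => /predU1P[->//|/xM /le_trans]; apply.
Qed.

(** A measurable type must be pointed and the type of orbit elements has no canonical point, so the
    point is a parameter. *)
Definition discrete_pointed (T : choiceType) (x0 : T) : Type := T.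

Section discrete_pointed.
Context (T : choiceType) (x0 : T).

HB.instance Definition _ := Choice.on (discrete_pointed x0).
HB.instance Definition _ := isPointed.Build (discrete_pointed x0) x0.
HB.instance Definition _ := @isMeasurable.Build default_measure_display
  (discrete_pointed x0) (@discrete_measurable T) (@discrete_measurable0 T)
  (@discrete_measurableC T) (@discrete_measurableU T).

End discrete_pointed.

(** * The finite factor given by a finite invariant family that covers the space *)

Section finite_orbit.
Context (R : realType) (G : groupType) (X : ptopologicalType).
Variables (act : homeo_action G X) (nu : probability (borel X) R).
Variable O : set (malg nu).
Hypothesis ns : nonsingular act nu.
Hypothesis Oact : forall g Z, O Z -> O (malg_act act g Z).
Hypothesis Odisj : ae_disjoint O.

Definition orbit_act (g : G) (y : set_type O) : set_type O :=
  exist _ (malg_act act g (\val y)) (mem_set (Oact g (set_valP y))).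

Lemma orbit_act_is_action : is_action orbit_act.
Proof.
split=> [x|g h x]; apply: val_inj => /=; first exact: malg_act1.
exact: malg_actM.
Qed.

Variable y0 : set_type O.

(** The cores are disjoint, so [x] lies in at most one. Points outside all cores, eventually a null
    set, go to the default [y0]. *)
Definition to_orbit (x : borel X) : discrete_pointed y0 :=
  xget y0 [set y : set_type O | core O (\val y) x].

Lemma to_orbit_core (y : set_type O) x : core O (\val y) x -> to_orbit x = y.
Proof.
move=> yx; apply: xget_unique => //= z zx; apply: val_inj.
by apply: (trivIset_core (set_valP z) (set_valP y)); exists x.
Qed.

Hypothesis Ofin : finite_set O.

Lemma finite_orbit_type : finite_set [set: set_type O].
Proof. by rewrite (eq_finite_set (card_setT O)). Qed.

Lemma measurable_to_orbit : measurable_fun setT to_orbit.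
Proof.
(* When [B] avoids the default [y0], its preimage is exactly a union of cores; otherwise pass to the
   complement. *)
suff H (B : set (set_type O)) : ~ B y0 -> measurable (to_orbit @^-1` B).
  move=> _ B _; rewrite setTI; have [By|nBy] := pselect (B y0); last exact: H.
  rewrite -[B]setCK preimage_setC; apply: measurableC.
  by apply: (H (~` B)) => /(_ By).
move=> By0; rewrite (_ : _ @^-1` _ = \bigcup_(y in B) core O (\val y)).
  apply: countable_bigcup_measurable => [|y _].
    by apply: finite_set_countable; apply: sub_finite_set finite_orbit_type.
  exact: (measurable_core _ (finite_set_countable Ofin)).
apply/seteqP; split=> x /=; last by move=> [y By /to_orbit_core ->].
rewrite /to_orbit; case: xgetP => [y _ /= yx By|_ /By0//].
by exists y.
Qed.

Hypothesis Ocover : nu (\bigcup_(Z in O) \val (repr Z)) = 1.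

Lemma orbit_cover : nu.-negligible (~` \bigcup_(Z in O) core O Z).
Proof.
have cO := finite_set_countable Ofin.
have mU : measurable (\bigcup_(Z in O) \val (repr Z) : set (borel X)).
  by apply: countable_bigcup_measurable => // Z _; exact: measurable_mset.
apply: (@negligibleS _ _ _ _ (~` (\bigcup_(Z in O) \val (repr Z)) `|`
   \bigcup_(Z in O) (\val (repr Z) `\` core O Z))) => [x nx|].
  have [[Z OZ Zx]|nU] :=
    pselect ((\bigcup_(Z in O) \val (repr Z)) x); last by left.
  by right; exists Z => //; split=> // Cx; apply: nx; exists Z.
apply: negligibleU.
  apply/negligibleP; first exact: measurableC.
  by rewrite [LHS]probability_setC// [X in _ - X]Ocover subee.
by apply: countable_negligible_bigcup => // Z OZ; exact: core_negligible.
Qed.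

Lemma preimage_negligible g (A : set (borel X)) :
  nu.-negligible A -> nu.-negligible (borel_act act g @^-1` A).
Proof.
move=> [N [mN N0 AN]]; exists (borel_act act g @^-1` N); split.
- by rewrite -[_ @^-1` _]setTI; exact: measurable_borel_act.
- by have := ns g^-1%g mN N0; rewrite act_imageE invgK.
- by move=> x; exact: AN.
Qed.

(** For almost every [x], [x] lies in the core of some [Z] and [gx] in the core of some [W]. Almost
    surely [gx] is also in the representative of [gZ], and the core of [W] excludes every other
    member, so [W] is [gZ]. *)
Lemma to_orbit_equivariant g :
  {ae nu, forall x, to_orbit (borel_act act g x) = orbit_act g (to_orbit x)}.
Proof.
pose N := ~` \bigcup_(Z in O) core O Z.
(* The null discrepancy between the chosen representative of [gZ] and the translate of that of
   [Z]. *)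
pose E (Z : malg nu) :=
  \val (repr (malg_act act g Z)) `+` borel_act act g @` \val (repr Z).
have cO := finite_set_countable Ofin.
change (nu.-negligible (~` [set x |
  to_orbit (borel_act act g x) = orbit_act g (to_orbit x)])).
have nN : nu.-negligible (N `|` borel_act act g @^-1` N `|`
    borel_act act g @^-1` (\bigcup_(Z in O) E Z)).
  apply: negligibleU; first apply: negligibleU.
  - exact: orbit_cover.
  - exact/preimage_negligible/orbit_cover.
  - apply: preimage_negligible; apply: countable_negligible_bigcup => // Z OZ.
    apply/negligibleP; last exact: repr_malg_pi.
    by apply: measurableU; apply: measurableD;
      [| apply: measurable_act_image| apply: measurable_act_image|];
      exact: measurable_mset.
apply: negligibleS nN => x nx; apply: contrapT => nU; apply: nx.
have [Z OZ Zx] : (\bigcup_(Z in O) core O Z) x.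
  by apply: contrapT => nZ; apply: nU; left; left.
have [W OW Wx] : (\bigcup_(Z in O) core O Z) (borel_act act g x).
  by apply: contrapT => nZ; apply: nU; left; right.
have gZx : \val (repr (malg_act act g Z)) (borel_act act g x).
  apply: contrapT => nZ; apply: nU; right; exists Z => //; right; split=> //.
  by exists x => //; case: Zx.
have WE : W = malg_act act g Z.
  apply: contrapT => WZ; case: Wx => _; apply; exists (malg_act act g Z) => //.
  by split; [exact: Oact|move=> /esym].
rewrite /= (@to_orbit_core (exist _ W (mem_set OW)) _ Wx).
rewrite (@to_orbit_core (exist _ Z (mem_set OZ)) _ Zx).
by apply: val_inj.
Qed.

(** The fibre of [to_orbit] over a member contains its core, hence has at least its measure. Two
    distinct positive members thus give two points of positive mass. *)
Lemma finite_orbit_factor Y Z : O Y -> O Z -> Y <> Z ->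
  0 < malg_measure Y -> 0 < malg_measure Z ->
  has_nontrivial_finite_factor act nu.
Proof.
move=> OY OZ YZ Y0 Z0.
have cO := finite_set_countable Ofin.
pose pi : {mfun borel X >-> discrete_pointed y0} :=
  mfun_Sub (mem_set measurable_to_orbit).
have pos (y : discrete_pointed y0) : 0 < malg_measure (\val y) ->
    0 < distribution nu pi [set y].
  rewrite -(measure_core cO Odisj (set_valP y)) => /lt_le_trans; apply.
  apply: le_measure.
  - exact/mem_set/measurable_core.
  - apply: mem_set; rewrite -[X in measurable X]setTI.
    by apply: measurable_to_orbit.
  - by move=> x yx; exact: to_orbit_core.
exists _, (discrete_pointed y0), (distribution nu pi), orbit_act, pi; split.
- by split; [exact: finite_orbit_type|].
- exact: orbit_act_is_action.
- by [].
- exact: to_orbit_equivariant.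
- exists (exist _ Y (mem_set OY)), (exist _ Z (mem_set OZ)).
  by split; [move=> []|exact: pos|exact: pos].
Qed.

End finite_orbit.

(** * Covering the space by an orbit, through ergodicity *)

Lemma positive_orbit_cover (R : realType) (G : groupType) (X : ptopologicalType)
    (act : homeo_action G X) (nu : probability (borel X) R) (Y : malg nu) :
  countable [set: G] -> nonsingular act nu -> ergodic act nu ->
  0 < malg_measure Y ->
  nu (\bigcup_(Z in malg_orbit act Y) \val (repr Z)) = 1.
Proof.
move=> cG ns erg Y0.
have cO := countable_malg_orbit act Y cG.
(* Ergodicity is stated for strictly invariant sets. The union of the actual translates of one
   representative is such a set, while the union of chosen representatives may be invariant only up
   to null sets. *)
pose A : set (borel X) :=
  \bigcup_(g in [set: G]) borel_act act g @` \val (repr Y).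
have mA : measurable A.
  apply: countable_bigcup_measurable => // g _.
  by apply: measurable_act_image; exact: measurable_mset.
have mU :
    measurable (\bigcup_(Z in malg_orbit act Y) \val (repr Z) : set (borel X)).
  by apply: countable_bigcup_measurable => // Z _; exact: measurable_mset.
have YA : malg_measure Y <= nu A.
  apply: le_measure; [exact/mem_set/measurable_mset|exact: mem_set|].
  by move=> x Yx; exists 1%g => //; rewrite act_image1.
have A1 : nu A = 1.
  have [g|A0|//] := erg A mA.
    apply/seteqP; split=> [_ [x [h _ hx] <-]|x [h _ hx]].
      by exists (g * h)%g => //; rewrite act_imageM; exists x.
    rewrite -[x](_ : borel_act act g (borel_act act g^-1%g x) = x); last first.
      have [a1 aM] := act_is_action act.
      by rewrite /borel_act -aM mulgV a1.
    exists (borel_act act g^-1%g x) => //; exists (g^-1 * h)%g => //.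
    by rewrite act_imageM; exists x.
  by move: Y0; rewrite ltNge => /negP[]; rewrite -A0.
apply/eqP; rewrite eq_le probability_le1//= -A1.
have nD : nu (A `\` \bigcup_(Z in malg_orbit act Y) \val (repr Z)) = 0.
  apply/negligibleP; first exact: measurableD.
  apply: (@negligibleS _ _ _ _ (\bigcup_(g in [set: G])
      (\val (repr (malg_act act g Y)) `+` borel_act act g @` \val (repr Y)))).
    move=> x [[g _ gx] nU]; exists g => //; right; split=> // gYx; apply: nU.
    by exists (malg_act act g Y) => //; exists g.
  apply: countable_negligible_bigcup => // g _; apply/negligibleP.
    by apply: measurableU; apply: measurableD;
      [| apply: measurable_act_image| apply: measurable_act_image|];
      exact: measurable_mset.
  exact: repr_malg_pi.
rewrite -(measureU0 mU (measurableD mA mU) nD).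
apply: le_measure; [exact: mem_set| |].
  by apply: mem_set; apply: measurableU => //; exact: measurableD.
by move=> x Ax; have [Ux|nUx] := pselect ((\bigcup_(Z in malg_orbit act Y)
  \val (repr Z)) x); [left|right].
Qed.

(** * Collapse of the orbit to a single element *)

Theorem theorem6p2 (R : realType) (G : groupType) (X : ptopologicalType)
    (act : homeo_action G X) (mu : probability (discrete_group G) R)
    (nu : probability (borel X) R) (F : set (malg nu)) :
  countable [set: G] ->
  compact [set: X] ->
  hausdorff_space X ->
  generating mu ->
  stationary act mu nu ->
  ergodic act nu ->
  ~ has_nontrivial_finite_factor act nu ->
  noetherian_lower_semilattice act F ->
  forall Y, F Y -> malg_measure Y = 0 \/ malg_measure Y = 1.
Proof.
move=> cG _ _ gen st erg nofactor NF Z FZ.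
have ns := stationary_nonsingular gen st.
have [Z0|/negP] := boolP (0 < malg_measure Z); last first.
  by rewrite lt0e malg_measure_ge0 andbT => /negP/negPn/eqP ->; left.
right; have [Y YZ mY] := noetherian_positive_minimal NF FZ Z0.
have Y0 := pm_gt0 mY.
pose O := malg_orbit act Y.
have OY : O Y by exists 1%g => //; exact: malg_act1.
have Oact g W : O W -> O (malg_act act g W) by exact: malg_orbit_act.
have dO : ae_disjoint O := ae_disjoint_malg_orbit ns NF mY.
have cO : countable O := countable_malg_orbit act Y cG.
(* Restricting to translates at least as large as [Y] leaves a nonempty finite set, so a maximum [W]
   exists; the discarded translates are smaller. *)
have [W [OW YW] Wmax'] : exists2 W, O W /\ malg_measure Y <= malg_measure W &
    forall V, O V /\ malg_measure Y <= malg_measure V ->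
      malg_measure V <= malg_measure W.
  apply: (@finite_set_max _ _
      [set V | O V /\ malg_measure Y <= malg_measure V]).
    apply: (@ae_disjoint_finite _ _ _ _ _ (malg_measure Y)) => //.
    - by apply: sub_countable cO; apply: subset_card_le => V [].
    - by move=> V V' [OV _] [OV' _]; exact: dO.
    - by move=> V [].
  by exists Y; split.
have Wmax V : O V -> malg_measure V <= malg_measure W.
  move=> OV; have [YV|/ltW VY] := leP (malg_measure Y) (malg_measure V).
    exact: Wmax'.
  exact: le_trans YW.
(* Every translate of [Y] is also a translate of [W], to which the maximum principle applies. *)
have Oconst V : O V -> malg_measure V = malg_measure W.
  case: OW Wmax => g _ <- Wmax [h _ <-].
  have -> : malg_act act h Y = malg_act act (h * g^-1)%g (malg_act act g Y).
    by rewrite -malg_actM// -mulgA mulVg mulg1.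
  by apply: (generating_max st gen Oact Wmax) => //; exists g.
have Ofin : finite_set O.
  by apply: (@ae_disjoint_finite _ _ _ _ _ (malg_measure Y)) => // V /Oconst ->.
have O1 : nu (\bigcup_(V in O) \val (repr V)) = 1.
  exact: positive_orbit_cover.
have OE : O = [set Y].
  apply/seteqP; split=> [V OV /=|_ -> //]; apply: contrapT => VY.
  apply: nofactor; apply: (finite_orbit_factor ns Oact dO
    (exist _ Y (mem_set OY)) Ofin O1 OV OY VY) => //.
  by rewrite (Oconst _ OV) (lt_le_trans Y0).
(* The representative of [Y] alone now has full measure, and [Z] lies above [Y]. *)
move: O1; rewrite OE bigcup_set1 => Y1.
apply/eqP; rewrite eq_le -{2}Y1 (le_malg_measure YZ) andbT.
by apply: probability_le1; exact: measurable_mset.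
Qed.
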